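(* For all integers $k\ge h\ge 1$, $$\widetilde{P}_2(e_ke_h)=(n-k)(n-k-1)\,e_{k-1}e_{h-1}-(2n-h-k-1)\sum_{i=1}^{h-1}(k-h+2i)\,e_{k-1+i}e_{h-1-i}.$$
   Context: Let $n\ge 2$ and let $e_k=e_k(x_2,x_3,\dots,x_n)$ be the elementary symmetric polynomial of degree $k$ in the $n-1$ variables $x_2,\dots,x_n$ ($e_0=1$, and $e_k=0$ for $k<0$ or $k>n-1$). With $\partial_i=\partial/\partial x_i$, the operator $\widetilde{P}_2$ is $$\widetilde{P}_2=\sum_{2\le i<j\le n}\frac{1}{x_i-x_j}\left(x_i\partial_i^2-x_j\partial_j^2\right).$$ *)

(* Defs.v *)
From HB Require Import structures.
From mathcomp Require Import all_boot all_order all_algebra.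
From mathcomp Require Import mpoly.

Set Implicit Arguments.
Unset Strict Implicit.
Unset Printing Implicit Defensive.

Import GRing.Theory.
Local Open Scope ring_scope.

Notation "x %:F" := (@tofrac _ x) : ring_scope.

(* The n - 1 variables x_2, ..., x_n are 'X_0, ..., 'X_(n-2): the index
   i : 'I_n.-1 stands for x_(i+2).  Since 1 / (x_i - x_j) need not send
   polynomials to polynomials, the operator takes values in the field of
   rational functions. *)
Definition Ptilde2 (R : idomainType) (n : nat) (p : {mpoly R[n.-1]}) :
    {fraction {mpoly R[n.-1]}} :=
  \sum_(i < n.-1) \sum_(j < n.-1 | (i < j)%N)
    (('X_i - 'X_j)%:F)^-1 *
    ('X_i * p^`M(i)^`M(i) - 'X_j * p^`M(j)^`M(j))%:F.

Definition esympoly (R : idomainType) (n k : nat) : {mpoly R[n.-1]} :=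
  mesym n.-1 R k.

Arguments Ptilde2 {R} n p.
Arguments esympoly R n k : clear implicits.

(* Main.v *)
Require Import Defs.
From HB Require Import structures.
From mathcomp Require Import all_boot all_order all_algebra.
From mathcomp Require Import mpoly ring.

Import GRing.Theory.
Local Open Scope ring_scope.

(** Write d_i for the derivation in the i-th variable, m = n - 1 for the number
    of variables, and e_r for the elementary symmetric polynomials.  Since e_r
    is affine in each variable, d_i d_i (e_k e_h) = 2 (d_i e_k) (d_i e_h), and
    d_i e_(r+1) is the elementary symmetric polynomial e_r of the variables
    other than x_i; everything rests on the resulting splitting
      e_r = d_i e_(r+1) + x_i (d_i e_r)                       [mesym_split]
    and on its consequences
      sum_i x_i (d_i e_r) = r e_r   and   sum_i d_i e_(r+1) = (m - r) e_r.

    Splitting e_k and e_h along both x_i and x_j shows that x_i - x_j divides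
    the numerator of the (i, j) term, and that the quotient is symmetric in i
    and j.  It can be written as T_ij + T_ji, where T_ij involves the second
    derivatives linearly [pair_numeratorE].  The sum over i < j thus becomes
    the sum of all the T_ij minus its diagonal, and summing first over one
    index turns each second derivative into a first one.  With
      D(k, h) = sum_i (d_i e_k) (d_i e_h)
    the operator therefore sends e_k e_h to
      (2n - k - h - 1) D(k, h) - (n - k) (n - h) e_(k-1) e_(h-1)
    [sum_pair_term].

    It remains to compute D.  Splitting along x_i both e_(h-1), in D(k, h), and
    e_k, in D(k+1, h-1), produces the same sum of x_i (d_i e_k) (d_i e_(h-1)),
    so that
      D(k, h) - D(k+1, h-1) = (n - k) e_(k-1) e_(h-1) - (n - h + 1) e_k e_(h-2)
    [mderiv_pairing_shift].  Iterating down to h = 0, where D vanishes, each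
    product e_(k-1+i) e_(h-1-i) with i > 0 is reached from two consecutive
    steps and gets (n - k - i) - (n - h + i) = - (k - h + 2i).  The product
    e_(k-1) e_(h-1) gets n - k from D, hence in total
    (n - k) ((2n - k - h - 1) - (n - h)) = (n - k) (n - k - 1). *)

Lemma mderiv_mesym1 (R : comNzRingType) (n : nat) (i : 'I_n) (A : {set 'I_n}) :
  ('X_[R, mesym1 A])^`M(i) = if i \in A then 'X_[mesym1 (A :\ i)] else 0.
Proof.
rewrite mderivX mnmE; case: ifP => iA; last by rewrite scale0r.
rewrite scale1r; congr 'X_[_]; apply/mnmP => j.
rewrite mnmBE mnm1E !mnmE in_setD1 [j == i]eq_sym.
by case: (i =P j) iA => [<- ->|_ _]; rewrite ?subn0.
Qed.

Lemma mpolyX_mderiv_mesym1 (R : comNzRingType) (n : nat) (i : 'I_n)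
    (A : {set 'I_n}) :
  'X_i * ('X_[R, mesym1 A])^`M(i) = if i \in A then 'X_[mesym1 A] else 0.
Proof.
rewrite mderiv_mesym1; case: ifP => iA; last by rewrite mulr0.
rewrite -mpolyXD; congr 'X_[_]; apply/mnmP => j.
rewrite mnmDE mnm1E !mnmE in_setD1 [j == i]eq_sym.
by case: (i =P j) iA => [<- ->|_ _]; rewrite ?subn0.
Qed.

(** Square-free monomials of degree r that contain x_i come from x_i (d_i e_r),
    the others from d_i e_(r+1) by inserting x_i before deriving. *)
Lemma mesym_split (R : comNzRingType) (n r : nat) (i : 'I_n) :
  (mesym n R r.+1)^`M(i) + 'X_i * (mesym n R r)^`M(i) = mesym n R r.
Proof.
rewrite !mesymE !raddf_sum mulr_sumr /=.
rewrite [RHS](bigID (fun A : {set 'I_n} => i \in A)) /= addrC.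
congr (_ + _); last first.
  rewrite [RHS]big_mkcondr /=.
  by apply: eq_bigr => A _; rewrite mpolyX_mderiv_mesym1.
under eq_bigr => A _ do rewrite mderiv_mesym1.
rewrite -big_mkcondr /=.
rewrite (reindex_onto (fun A => i |: A) (fun A => A :\ i)) /=; last first.
  by move=> A /andP[_ iA]; rewrite setD1K.
apply: eq_big => [A|A /andP[_ /eqP ->] //].
rewrite setU11 andbT cardsU1; case: (boolP (i \in A)) => iA /=.
  rewrite andbF; apply/negbTE; rewrite negb_and; apply/orP; right.
  by apply: contraTneq iA => <-; rewrite setD11.
by rewrite setU1K // eqxx !andbT add1n eqSS.
Qed.

(** Euler's identity for the homogeneous e_r: a set of size r is counted once
    for each of its elements. *)
Lemma mesym_euler (R : comNzRingType) (n r : nat) :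
  \sum_(i < n) 'X_i * (mesym n R r)^`M(i) = r%:R * mesym n R r.
Proof.
rewrite mulr_natl mesymE; under eq_bigr => i _ do rewrite raddf_sum mulr_sumr.
rewrite exchange_big -sumrMnl; apply: eq_bigr => A /eqP <-.
under eq_bigr => i _ do rewrite mpolyX_mderiv_mesym1.
by rewrite -big_mkcond sumr_const.
Qed.

Lemma sum_mderiv_mesymS (R : comNzRingType) (n r : nat) :
  \sum_(i < n) (mesym n R r.+1)^`M(i) = (n%:R - r%:R) * mesym n R r.
Proof.
under eq_bigr => i _ do
  rewrite -[_^`M(i)](addrK ('X_i * (mesym n R r)^`M(i))) mesym_split.
by rewrite sumrB mesym_euler sumr_const card_ord mulrBl !mulr_natl.
Qed.

Lemma mderiv_mesym0 (R : comNzRingType) (n : nat) (i : 'I_n) :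
  (mesym n R 0)^`M(i) = 0.
Proof. by rewrite mesym0E mderivC. Qed.

(** Each variable has degree at most 1 in e_r.  Deriving [mesym_split] gives
    d_i d_i e_(r+1) = - x_i (d_i d_i e_r), whence the induction. *)
Lemma mderiv2_mesym (R : comNzRingType) (n r : nat) (i : 'I_n) :
  (mesym n R r)^`M(i)^`M(i) = 0.
Proof.
elim: r => [|r IHr]; first by rewrite mderiv_mesym0 mderiv0.
have := congr1 (mderiv i) (mesym_split R n r i).
rewrite mderivD mderivM IHr mulr0 addr0 mderivX mnm1E eqxx scale1r.
rewrite (_ : (_ - _)%MM = 0%MM) ?mpolyX0 ?mul1r; last first.
  by apply/mnmP => j; rewrite mnmBE subnn mnm0E.
by move=> /(canRL (addrK _)); rewrite subrr.
Qed.

(** [mesym_split] in the variables other than x_i, obtained by applying d_i. *)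
Lemma mderiv_mesym_split (R : comNzRingType) (n r : nat) (i j : 'I_n) :
  i != j ->
  (mesym n R r.+1)^`M(i)^`M(j) + 'X_j * (mesym n R r)^`M(i)^`M(j)
  = (mesym n R r)^`M(i).
Proof.
move=> nij; rewrite -[in RHS](mesym_split R n r j) mderivD mderivM.
rewrite mderivX mnm1E eq_sym (negbTE nij) scale0r mul0r add0r.
by rewrite !(mderiv_comm j i).
Qed.

(** T_ij, for i != j half of the quotient of the (i, j) numerator by x_i - x_j,
    and extended by the same formula to i = j.  With a_r = e_r in the variables
    other than x_i and x_j, this half is
    a_(k-1) a_(h-1) - x_i x_j a_(k-2) a_(h-2).  It is written here so that the
    double sum over i and j factors: in the first product each factor depends
    on one index, and in each correction term the second derivative can be
    summed over an index on which the other factors do not depend. *)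
Definition pair_term (R : comNzRingType) (n k h : nat) (i j : 'I_n) :
    {mpoly R[n]} :=
  (mesym n R k)^`M(j) * (mesym n R h)^`M(i)
  - 'X_i * (mesym n R k)^`M(i)^`M(j) * (mesym n R h)^`M(i)
  - 'X_j * (mesym n R h)^`M(j)^`M(i) * (mesym n R k)^`M(j).

(** As e_k and e_h are affine in x_i and in x_j, all first derivatives are
    polynomials in x_i, x_j and the four mixed second derivatives d_i d_j of
    e_k, e_(k+1), e_h and e_(h+1); the identity then holds in these
    indeterminates. *)
Lemma pair_numeratorE (R : comNzRingType) (n k h : nat) (i j : 'I_n) :
  i != j -> let p := mesym n R k * mesym n R h in
  'X_i * p^`M(i)^`M(i) - 'X_j * p^`M(j)^`M(j)
  = ('X_i - 'X_j) * (pair_term R n k h i j + pair_term R n k h j i).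
Proof.
move=> nij /=; rewrite /pair_term !(mderivD, mderivM) !mderiv2_mesym.
have nji : j != i by rewrite eq_sym.
have Ei r := mderiv_mesym_split R n r i j nij.
have Ej r : (mesym n R r.+1)^`M(i)^`M(j) + 'X_i * (mesym n R r)^`M(i)^`M(j)
    = (mesym n R r)^`M(j).
  by rewrite -(mderiv_mesym_split R n r j i nji) !(mderiv_comm j i).
rewrite !(mderiv_comm j i).
move: (Ei k) (Ei h) (Ej k) (Ej h).
set ak := (mesym n R k)^`M(i)^`M(j); set ah := (mesym n R h)^`M(i)^`M(j).
by move=> <- <- <- <-; ring.
Qed.

Lemma sum_ltn_sym (V : zmodType) (n : nat) (F : 'I_n -> 'I_n -> V) :
  \sum_(i < n) \sum_(j < n | (i < j)%N) (F i j + F j i)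
  = \sum_(i < n) \sum_(j < n) F i j - \sum_(i < n) F i i.
Proof.
under eq_bigr => i _ do rewrite big_split.
rewrite big_split /= [X in _ + X](exchange_big_dep xpredT) //=.
rewrite -big_split -sumrB /=; apply: eq_bigr => i _.
rewrite [X in _ = X - _](bigD1 i) //= [F i i + _]addrC addrK.
rewrite [RHS](bigID (fun j : 'I_n => (i < j)%N)) /=.
congr (_ + _); apply: eq_bigl => j.
  by rewrite -(inj_eq val_inj) /=; case: ltngtP.
by rewrite -(inj_eq val_inj) /=; case: ltngtP.
Qed.

Definition mderiv_pairing (R : comNzRingType) (n k h : nat) : {mpoly R[n]} :=
  \sum_(i < n) (mesym n R k)^`M(i) * (mesym n R h)^`M(i).

(** After summing one index, the correction terms of T_ij contain
    x_i (d_i e_r), which [mesym_split] replaces by e_r - d_i e_(r+1); this is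
    how the products e_k e_h and the pairing D appear. *)
Lemma sum_pair_term (R : comNzRingType) (n k h : nat) :
  \sum_(i < n) \sum_(j < n) pair_term R n k.+1 h.+1 i j
    - \sum_(i < n) pair_term R n k.+1 h.+1 i i
  = (n%:R + n%:R - k%:R - h%:R - 1) * mderiv_pairing R n k.+1 h.+1
    - (n%:R - k%:R) * (n%:R - h%:R) * (mesym n R k * mesym n R h).
Proof.
set D := mderiv_pairing _ _ _ _.
(* Summing the outer derivative first: the constant n - r commutes with d_i. *)
have sum2 r (i : 'I_n) : \sum_(j < n) (mesym n R r.+1)^`M(i)^`M(j)
    = (n%:R - r%:R) * (mesym n R r)^`M(i).
  under eq_bigr => j _ do rewrite mderiv_comm.
  rewrite -raddf_sum sum_mderiv_mesymS /= mderivM.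
  by rewrite -!mpolyC_nat -mpolyCB mderivC mul0r add0r.
(* Second derivatives in one variable vanish, so T_ii is a plain product. *)
have diag : \sum_(i < n) pair_term R n k.+1 h.+1 i i = D.
  apply: eq_bigr => i _; rewrite /pair_term !mderiv2_mesym.
  by rewrite !mulr0 !mul0r !subr0.
(* Either correction term of T_ij, up to exchanging the roles of i and j. *)
have cross r s : \sum_(i < n) \sum_(j < n)
    'X_i * (mesym n R r.+1)^`M(i)^`M(j) * (mesym n R s.+1)^`M(i)
  = (n%:R - r%:R) * ((n%:R - s%:R) * (mesym n R r * mesym n R s)
                     - mderiv_pairing R n r.+1 s.+1).
  under eq_bigr => i _.
    rewrite -mulr_suml -mulr_sumr sum2.
    rewrite (_ : _ * _ = (n%:R - r%:R) *
       (mesym n R r * (mesym n R s.+1)^`M(i)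
       - (mesym n R r.+1)^`M(i) * (mesym n R s.+1)^`M(i))); last first.
      by rewrite -[X in _ = _ * (X * _ - _)](mesym_split R n r i); ring.
    over.
  rewrite -mulr_sumr sumrB -mulr_sumr sum_mderiv_mesymS.
  by rewrite /mderiv_pairing; ring.
have DC : mderiv_pairing R n h.+1 k.+1 = D.
  by apply: eq_bigr => i _; rewrite mulrC.
rewrite diag /pair_term.
under eq_bigr => i _ do rewrite sumrB sumrB.
rewrite sumrB sumrB cross [X in _ - X - D]exchange_big /= cross DC -/D.
under eq_bigr => i _ do rewrite -mulr_suml sum_mderiv_mesymS.
rewrite -mulr_sumr sum_mderiv_mesymS.
ring.
Qed.

(** Both sums on the left leave the same remainder, the sum of
    x_i (d_i e_(k+1)) (d_i e_h), which cancels in the difference.  The last sum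
    is kept unevaluated because its closed form, through
    [sum_mderiv_mesymS], needs h > 0, while the case h = 0 starts the
    induction below. *)
Lemma mderiv_pairing_shift (R : comNzRingType) (n k h : nat) :
  mderiv_pairing R n k.+1 h.+1 - mderiv_pairing R n k.+2 h
  = (n%:R - k%:R) * (mesym n R k * mesym n R h)
    - \sum_(i < n) mesym n R k.+1 * (mesym n R h)^`M(i).
Proof.
rewrite /mderiv_pairing mulrA -sum_mderiv_mesymS mulr_suml.
rewrite -!sumrB; apply: eq_bigr => i _.
rewrite -[X in _ = _ * X - _](mesym_split R n h i).
by rewrite -[X in _ = _ - X * _](mesym_split R n k.+1 i); ring.
Qed.

Lemma mderiv_pairingE (R : comNzRingType) (n k h : nat) :
  mderiv_pairing R n k.+1 h.+1
  = (n%:R - k%:R) * (mesym n R k * mesym n R h)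
    - \sum_(1 <= i < h.+1) (k%:R - h%:R + i%:R + i%:R) *
        (mesym n R (k + i) * mesym n R (h - i)).
Proof.
elim: h k => [|h IHh] k.
  have := mderiv_pairing_shift R n k 0.
  rewrite big_geq // subr0 big1 => [|i _]; last by rewrite mderiv_mesym0 mulr0.
  rewrite /mderiv_pairing [X in _ - X]big1 ?subr0 // => i _.
  by rewrite mderiv_mesym0 mulr0.
have /(canRL (subrK _)) -> := mderiv_pairing_shift R n k h.+1.
rewrite -mulr_sumr sum_mderiv_mesymS IHh [in RHS]big_ltn // big_add1 /=.
rewrite addn1 subn1 /=.
(* The first term of the range was set apart; shifting the index of the others
   by one matches them with the sum for (k + 1, h). *)
rewrite [in RHS](eq_bigr (fun i => (k.+1%:R - h%:R + i%:R + i%:R) *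
    (mesym n R (k.+1 + i) * mesym n R (h - i)))) => [|i _]; last first.
  by rewrite addSnnS subSS; congr (_ * _); ring.
ring.
Qed.

(** The denominators x_i - x_j are nonzero, so they cancel in the fraction
    field and the operator takes a polynomial value on e_k e_h. *)
Lemma Ptilde2_mesymM (R : idomainType) (n k h : nat) :
  Ptilde2 n (esympoly R n k * esympoly R n h)
  = (\sum_(i < n.-1) \sum_(j < n.-1) pair_term R _ k h i j
      - \sum_(i < n.-1) pair_term R _ k h i i)%:F.
Proof.
rewrite -sum_ltn_sym raddf_sum; apply: eq_bigr => i _.
rewrite [RHS]raddf_sum; apply: eq_bigr => j lt_ij.
have nij : i != j by rewrite -(inj_eq val_inj) neq_ltn lt_ij.
rewrite pair_numeratorE // tofracM mulKf // tofrac_eq0 subr_eq0.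
apply: contra nij => /eqP /(congr1 (mcoeff U_(i))).
rewrite !mcoeffXU eqxx eq_sym.
by case: eqP => // _ /eqP; rewrite oner_eq0.
Qed.

Theorem lemma5p5 (R : idomainType) (n k h : nat) :
  (2 <= n)%N -> (1 <= h)%N -> (h <= k)%N ->
  Ptilde2 n (esympoly R n k * esympoly R n h) =
  (((n%:R - k%:R) * (n%:R - k%:R - 1)) *:
     (esympoly R n (k - 1) * esympoly R n (h - 1))
   - (2%:R * n%:R - h%:R - k%:R - 1) *:
     (\sum_(1 <= i < h)
        (k%:R - h%:R + 2%:R * i%:R) *:
          (esympoly R n (k - 1 + i) * esympoly R n (h - 1 - i))))%:F.
Proof.
rewrite Ptilde2_mesymM => n2 h1 hk.
case: h h1 hk => // h _; case: k => // k _; rewrite !subn1 /=.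
case: n n2 => // m _ /=.
(* From here on m, k and h stand for n - 1, k - 1 and h - 1. *)
rewrite sum_pair_term mderiv_pairingE /esympoly /=; congr (_%:F).
rewrite [in RHS](eq_bigr (fun i => (k%:R - h%:R + i%:R + i%:R) *
    (mesym m R (k + i) * mesym m R (h - i)))) => [|i _]; last first.
  rewrite -mul_mpolyC !(rmorphD, rmorphB, rmorphM, rmorph_nat) /=.
  by congr (_ * _); ring.
rewrite -!mul_mpolyC !(rmorphM, rmorphB, rmorph_nat, rmorph1) /=.
ring.
Qed.
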